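(* The relation of being split homeomorphic is an equivalence relation on the class of topological spaces; that is, it is reflexive, symmetric and transitive.
   Context: A neighborhood of a point $p$ (respectively of a subset $S$) in a topological space is a set $V$, not necessarily open, for which there is an open set $U$ with $p \in U \subseteq V$ (respectively $S \subseteq U \subseteq V$). Let $f : X \to Y$ be a function between topological spaces and $p \in X$. The function $f$ is multi-split continuous at $p$ if there exists a finite non-empty set $Z_p \subseteq Y$ such that: (a) for every $y \in Z_p$ and all neighborhoods $U \subseteq X$ of $p$ and $V \subseteq Y$ of $y$ one has $f(U) \cap V \neq \varnothing$; (b) for every neighborhood $V \subseteq Y$ of the set $Z_p$ there exists a neighborhood $U \subseteq X$ of $p$ with $f(U) \subseteq V$. The function $f$ is globally multi-split continuous if it is multi-split continuous at every $p \in X$. A split homeomorphism is a bijection $f : X \to Y$ such that both $f$ and its inverse $f^{-1} : Y \to X$ are globally multi-split continuous. Two topological spaces $X$ and $Y$ are split homeomorphic if there exists a split homeomorphism $f : X \to Y$. *)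

(* Defs.v *)
From mathcomp Require Import all_boot all_order.
From mathcomp Require Import boolp classical_sets functions cardinality filter.
From mathcomp Require Import topology_structure separation_axioms.

Set Implicit Arguments.
Unset Strict Implicit.
Unset Printing Implicit Defensive.

Local Open Scope classical_set_scope.

(* [set_nbhs Z V] says that some open set lies between [Z] and [V]; see
   [set_nbhsP]. *)
Definition multi_split_continuous_at (X Y : topologicalType) (f : X -> Y)
    (p : X) : Prop :=
  exists Z : set Y,
    [/\ finite_set Z, Z !=set0,
        forall y : Y, Z y ->
          forall (U : set X) (V : set Y), nbhs p U -> nbhs y V ->
            (f @` U) `&` V !=set0
      & forall V : set Y, set_nbhs Z V ->
          exists2 U : set X, nbhs p U & f @` U `<=` V].

Definition multi_split_continuous (X Y : topologicalType) (f : X -> Y) : Prop :=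
  forall p : X, multi_split_continuous_at f p.

(* [g] is the inverse of the bijection [f], given explicitly as in [bijective],
   so that no default point is needed and empty spaces are covered. *)
Definition split_homeomorphism (X Y : topologicalType) (f : X -> Y) : Prop :=
  exists g : Y -> X,
    [/\ cancel f g, cancel g f, multi_split_continuous f
      & multi_split_continuous g].

Definition split_homeomorphic (X Y : topologicalType) : Prop :=
  exists f : X -> Y, split_homeomorphism f.

(* Main.v *)
Require Import Defs.
From mathcomp Require Import all_boot all_order.
From mathcomp Require Import boolp classical_sets functions cardinality filter.
From mathcomp Require Import topology_structure separation_axioms.
From mathcomp Require Import finmap compact.

(** Reflexivity holds because the identity, like any continuous map, is
    multi-split continuous with singleton value sets, and symmetry because a
    split homeomorphism is defined symmetrically in [f] and its inverse.
    Transitivity reduces to composing multi-split continuous functions [f] and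
    [g], and there the obvious candidate for the set of split values of
    [g \o f] at [p], namely the union [W] of the finite sets attached to [g] at
    the split values of [f] at [p], can be too large: a point [w] attached to [g] at [y]
    is approached along some points near [y], but [f] may miss all of those
    points near [p].

    The remedy is that clause (a) of the definition comes for free.  Clause (b)
    says that the filter [f @ p] converges to a finite set [Z], in the sense
    that it refines [set_nbhs Z], and clause (a) says that every point of [Z] is
    a cluster point of [f @ p].  A point of [Z] which is not a cluster point can
    be discarded, since it has a neighbourhood that [f] avoids near [p]; as [Z]
    is finite, all such points can be discarded at once
    ([cvg_finite_cluster]).  What remains is non-empty because [f @ p] is a
    proper filter.  Hence multi-split continuity amounts to convergence to some
    finite set ([multi_split_continuous_atP]), a property that composes well:
    a neighbourhood [V] of [W] pulls back under [g] to a neighbourhood of every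
    split value of [f] at [p]. *)

Local Open Scope classical_set_scope.

(** Each [y] in [A] has a set [O y] of [F] such that [V `|` ~` O y] is a
    neighbourhood of [y]: the whole space when [y] is a cluster point, and
    otherwise a set of [F] missing a neighbourhood of [y].  Finiteness of [A]
    makes the intersection [I] of the [O y] a set of [F], and [V `|` ~` I] is a
    neighbourhood of [A], hence also in [F]; the two meet inside [V]. *)
Lemma cvg_finite_cluster (Y : topologicalType) (F : set_system Y) (A : set Y) :
  Filter F -> finite_set A -> F `=>` set_nbhs A ->
  F `=>` set_nbhs (A `&` cluster F).
Proof.
move=> FF /finite_fsetP[s ->] FA V nbhsV.
have avoid y : exists O, F O /\ (y \in s -> nbhs y (V `|` ~` O)).
  have [Cy|] := pselect (cluster F y).
    exists setT; split; first exact: filterT.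
    move=> sy; apply: filterS (nbhsV y _); last by [].
    by move=> z; left.
  move=> /existsNP[O /existsNP[B /not_implyP[FO /not_implyP[yB OB]]]].
  exists O; split=> // _; apply: filterS yB => z Bz; right => Oz.
  by apply: OB; exists z.
have [O FO] := choice avoid.
have FI : F (\bigcap_(y in [set` s]) O y).
  by apply: filter_bigI => y _; exact: (FO y).1.
have FVI : F (V `|` ~` \bigcap_(y in [set` s]) O y).
  apply: FA => y sy; apply: filterS ((FO y).2 sy) => z [Vz|nOz]; first by left.
  by right=> /(_ _ sy).
by apply: filterS (filterI FI FVI) => z [Iz []].
Qed.

Lemma cvg_set_nbhs_neq0 (Y : topologicalType) (F : set_system Y) (A : set Y) :
  ProperFilter F -> F `=>` set_nbhs A -> A !=set0.
Proof.
move=> FF FA; have [A0|/set0P//] := eqVneq A set0.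
by case: (filter_not_empty F); apply: FA => y; rewrite A0.
Qed.

(** Clause (a) of the definition is recovered by keeping only the cluster points
    of [f @ p] among the points of [Z]. *)
Lemma multi_split_continuous_atP (X Y : topologicalType) (f : X -> Y) (p : X) :
  multi_split_continuous_at f p <->
  exists2 Z : set Y, finite_set Z & f @ p `=>` set_nbhs Z.
Proof.
split=> [[Z [Zfin _ _ fZ]]|[Z Zfin fZ]].
  by exists Z => // V /fZ[U pU /image_subP UV]; exact: filterS pU.
have fZc : f @ p `=>` set_nbhs (Z `&` cluster (f @ p)).
  exact: cvg_finite_cluster.
exists (Z `&` cluster (f @ p)); split.
- exact: sub_finite_set Zfin.
- exact: (cvg_set_nbhs_neq0 _ _ _ _ fZc).
- move=> y [_ yc] U V pU; apply: yc.
  by apply: filterS pU => x Ux; exists x.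
- by move=> V /fZc pV; exists (f @^-1` V) => //; exact: image_preimage_subset.
Qed.

Lemma continuous_multi_split_continuous (X Y : topologicalType) (f : X -> Y) :
  continuous f -> multi_split_continuous f.
Proof.
move=> fcont p; apply/multi_split_continuous_atP.
by exists [set f p] => [|V /(_ _ erefl) /fcont]; first exact: finite_set1.
Qed.

(** The finite sets attached to [g] at the split values of [f] at [p] are
    collected into a union; it converges by pulling neighbourhoods back first
    along [g], then along [f]. *)
Lemma multi_split_continuous_comp (X Y Z : topologicalType) (f : X -> Y)
    (g : Y -> Z) :
  multi_split_continuous f -> multi_split_continuous g ->
  multi_split_continuous (g \o f).
Proof.
move=> fs gs p; apply/multi_split_continuous_atP.
have /multi_split_continuous_atP[A Afin fA] := fs p.
have gW (y : Y) : exists W : set Z, finite_set W /\ g @ y `=>` set_nbhs W.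
  by have /multi_split_continuous_atP[W] := gs y; exists W.
have [W WP] := choice gW.
exists (\bigcup_(y in A) W y).
  by apply: bigcup_finite => // y _; exact: (WP y).1.
move=> V nbhsV; apply: (fA (g @^-1` V)) => y Ay; apply: (WP y).2 => z Wz.
by apply: nbhsV; exists y.
Qed.

Theorem proposition6p3 :
  [/\ forall X : topologicalType, split_homeomorphic X X,
      forall X Y : topologicalType,
        split_homeomorphic X Y -> split_homeomorphic Y X
    & forall X Y Z : topologicalType,
        split_homeomorphic X Y -> split_homeomorphic Y Z ->
        split_homeomorphic X Z].
Proof.
split=> [X|X Y [f [g [fK gK fs gs]]]|X Y Z].
- have ids : multi_split_continuous (@id X).
    by apply: continuous_multi_split_continuous => p; exact: cvg_id.
  by exists id, id; split.
- by exists g, f; split.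
- move=> [f [f' [fK f'K fs f's]]] [g [g' [gK g'K gs g's]]].
  exists (g \o f), (f' \o g'); split.
  + exact: can_comp.
  + exact: can_comp.
  + exact: multi_split_continuous_comp.
  + exact: multi_split_continuous_comp.
Qed.
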